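(* Let $P(y,dz)=\mathbb P(y+\zeta\in dz)$ be the transition kernel of a random walk $\{S_n\}$ on $\mathbb R$ with i.i.d. increments distributed as $\zeta$, let $s\in\mathbb R$, $\tau=\inf\{n\ge0:S_n>s\}$, let $v:\mathbb R\to(0,\infty)$ be measurable and $w(y)=\int v(z)P(y,dz)$, and let $\epsilon>0$. For a starting point $S_0=y\le s$ define $L=\mathbb 1_{\{\tau<\infty\}}\prod_{k=1}^\tau w(S_{k-1})/v(S_k)$. Assume $w(y)\in(0,\infty)$ for $y\le s$, and that there exist $\delta_1>0$ and a function $h:\mathbb R\to[\delta_1,\infty)$ with $$w(y)^{1+\epsilon}\int v(z)h(z)P(y,dz)\le h(y)v(y)^{2+\epsilon}\quad\text{for all }y\le s.$$ If moreover $h(z)\ge1$ and $v(z)\ge\delta_2$ for all $z>s$, for some $\delta_2>0$, then for every $y\le s$, $$\mathbb E_y[L^{1+\epsilon}]\le\delta_1^{-1}\delta_2^{-(2+\epsilon)}v(y)^{2+\epsilon}h(y),$$ where $\mathbb E_y$ denotes expectation under the original law of the random walk started at $y$. *)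

(* Defs.v *)
From HB Require Import structures.
From mathcomp Require Import all_boot all_order all_algebra.
From mathcomp Require Import all_classical all_reals all_analysis.
Set Implicit Arguments. Unset Strict Implicit. Unset Printing Implicit Defensive.
Import Order.TTheory GRing.Theory Num.Theory.
Local Open Scope classical_set_scope.
Local Open Scope ring_scope.

Section rw.
Context {R : realType} {d : measure_display} {Omega : measurableType d}.

Definition mutually_independent (Pr : probability Omega R)
  (X : nat -> Omega -> R) : Prop :=
  forall (I : seq nat) (B : nat -> set R), uniq I ->
    (forall i, measurable (B i)) ->
    Pr (\big[setI/setT]_(i <- I) (X i @^-1` B i)) =
    (\prod_(i <- I) Pr (X i @^-1` B i))%E.

Definition identically_distributed (Pr : probability Omega R)
  (X : nat -> Omega -> R) : Prop :=
  forall (k : nat) (B : set R), measurable B ->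
    Pr (X k @^-1` B) = Pr (X 0 @^-1` B).

Definition walk_kernel (Pr : probability Omega R) (zeta : Omega -> R) (y : R) :
  set R -> \bar R := pushforward Pr (fun om => y + zeta om).

Definition walk_w (Pr : probability Omega R) (zeta : Omega -> R) (v : R -> R)
  (y : R) : \bar R := (\int[walk_kernel Pr zeta y]_z (v z)%:E)%E.

Definition walk (X : nat -> Omega -> R) (y : R) (om : Omega) (n : nat) : R :=
  y + \sum_(k < n) X k om.

(* On {tau < oo}, tau is the least n with
   S_n > s (ex_minn); for k <= tau we have S_{k-1} <= s, where w is finite,
   so taking [fine] of w there is harmless. *)
Definition Lwalk (Pr : probability Omega R) (X : nat -> Omega -> R)
  (v : R -> R) (s y : R) (om : Omega) : R :=
  match pselect (exists n, s < walk X y om n) with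
  | left H =>
      \prod_(k < ex_minn H)
        (fine (walk_w Pr (X 0) v (walk X y om k)) / v (walk X y om k.+1))
  | right _ => 0
  end.

End rw.

(* Main.v *)
Require Import Defs.
From HB Require Import structures.
From mathcomp Require Import all_boot all_order all_algebra.
From mathcomp Require Import all_classical all_reals all_analysis.
From mathcomp Require Import measurable_realfun ring.
Import Order.TTheory GRing.Theory Num.Theory.
Set Implicit Arguments. Unset Strict Implicit. Unset Printing Implicit Defensive.
Local Open Scope classical_set_scope.
Local Open Scope ring_scope.

(* Let M_n be the product defining L truncated at n /\ tau, raised to the power
   1 + eps, and V(x, m) = m v(x)^(2+eps) h(x).  The hypothesis on h says exactly
   that V is superharmonic for the stopped chain (S_(n /\ tau), M_n), so
   E_y V(S_(n /\ tau), M_n) <= v(y)^(2+eps) h(y) for every n.  On the exit event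
   S_(n /\ tau) > s we have v >= delta2 and h >= delta1, hence
   M_n <= delta1^-1 delta2^-(2+eps) V; since L^(1+eps) is the nondecreasing
   limit of M_n 1_(S_(n /\ tau) > s), monotone convergence concludes.
   Independence of the increments enters only through the one-step formula
   E g(Y_(n+1)) = E \int g(F(Y_n, z)) P_zeta(dz) for a chain Y_(n+1) = F(Y_n, X_n). *)

(* The library's measure instance on [pushforward m f] is parameterized by the
   measurability proof of [f], so it cannot be inferred and is named here. *)
Definition pushforward_measure (R : realType) d1 d2 (T1 : measurableType d1)
  (T2 : measurableType d2) (m : {measure set T1 -> \bar R}) (f : T1 -> T2)
  (mf : measurable_fun setT f) : {measure set T2 -> \bar R} :=
  measure_function_pushforward__canonical__measure_function_Measure m mf.

Definition mfun_of d1 d2 (T1 : measurableType d1) (T2 : measurableType d2)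
  (f : T1 -> T2) (mf : measurable_fun setT f) : {mfun T1 >-> T2} :=
  HB.pack f (isMeasurableFun.Build _ _ _ _ f mf).

Lemma finite_measure_prod_unique (R : realType) d1 d2 (T1 : measurableType d1)
  (T2 : measurableType d2) (m1 m2 : {measure set (T1 * T2) -> \bar R}) :
  (m1 setT < +oo)%E ->
  (forall A B, measurable A -> measurable B -> m1 (A `*` B) = m2 (A `*` B)) ->
  forall G, measurable G -> m1 G = m2 G.
Proof.
move=> m1oo m12 G mG.
pose C : set (set (T1 * T2)) :=
  [set C | exists A, measurable A /\ exists B, measurable B /\ C = A `*` B].
have CI : setI_closed C.
  move=> /= _ _ [X1 [mX1 [X2 [mX2 ->]]]] [Y1 [mY1 [Y2 [mY2 ->]]]].
  rewrite -setXI; exists (X1 `&` Y1); split; first exact: measurableI.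
  by exists (X2 `&` Y2); split => //; exact: measurableI.
apply: (measure_unique C (fun _ => setT)) => //.
- rewrite measurable_prod_measurableType //; congr (<<s _ >>).
  rewrite predeqE; split => [[A mA [B mB <-]]|[A [mA [B [mB ->]]]]].
    by exists A; split => //; exists B.
  by exists A => //; exists B.
- by move=> _; exists setT; split => //; exists setT; split => //; rewrite setXTT.
- by rewrite bigcup_const.
- by move=> A [A1 [mA1 [A2 [mA2 ->]]]]; exact: m12.
Qed.

Lemma powR_div (R : realType) (a b r : R) : 0 <= a -> 0 < b ->
  (a / b) `^ r = a `^ r * b `^ (- r).
Proof.
move=> a0 b0; rewrite powRM ?invr_ge0 ?(ltW b0) //; congr (_ * _).
have brV : b `^ r * (b^-1) `^ r = 1.
  by rewrite -powRM ?invr_ge0 ?ltW // mulfV ?gt_eqF // powR1.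
by rewrite powRN -[LHS]mul1r -(mulVf (lt0r_neq0 (powR_gt0 r b0))) -mulrA brV mulr1.
Qed.

Lemma powR_prod (R : realType) (I : Type) (r : seq I) (F : I -> R) (q : R) :
  (forall i, 0 <= F i) ->
  (\prod_(i <- r) F i) `^ q = \prod_(i <- r) (F i `^ q).
Proof.
move=> F0; elim: r => [|i r IH]; first by rewrite !big_nil powR1.
by rewrite !big_cons powRM ?IH ?prodr_ge0.
Qed.

Lemma integral_walk_kernel (R : realType) d (Omega : measurableType d)
  (Pr : probability Omega R) (zeta : Omega -> R)
  (mzeta : measurable_fun setT zeta) (u : R) (g : R -> R) :
  measurable_fun setT g -> (forall z, 0 <= g z) ->
  (\int[walk_kernel Pr zeta u]_z (g z)%:E =
   \int[distribution Pr (mfun_of mzeta)]_x (g (u + x))%:E)%E.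
Proof.
move=> mg g0.
have mux : measurable_fun setT (fun om => u + zeta om).
  by apply: measurable_funD => //; exact: measurable_cst.
rewrite /walk_kernel (ge0_integral_pushforward mux) //; last first.
- by move=> z _; rewrite lee_fin.
- exact/measurable_EFinP.
rewrite ge0_integral_distribution //; last by move=> z; rewrite lee_fin.
apply/measurable_EFinP; apply: measurableT_comp => //.
by apply: measurable_funD => //; exact: measurable_cst.
Qed.

Section independent_inputs.
Context (R : realType) d (Omega : measurableType d) (Pr : probability Omega R)
  (X : nat -> Omega -> R) (mX : forall k, measurable_fun setT (X k))
  (indX : mutually_independent Pr X) (idX : identically_distributed Pr X).

Local Notation mu := (distribution Pr (mfun_of (mX 0))).

Definition cylinder (I : seq nat) (B : nat -> set R) : set Omega :=
  \big[setI/setT]_(i <- I) X i @^-1` B i.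

Lemma measurable_cylinder I B :
  (forall i, measurable (B i)) -> measurable (cylinder I B).
Proof.
move=> mB; rewrite /cylinder; elim: I => [|i I IH]; rewrite ?big_nil ?big_cons //.
by apply: measurableI => //; exact: (measurable_funPTI (mfun_of (mX i))).
Qed.

Lemma cylinder_cons k I B Bk : k \notin I ->
  cylinder (k :: I) (fun i => if i == k then Bk else B i) =
  X k @^-1` Bk `&` cylinder I B.
Proof.
move=> kI; rewrite /cylinder big_cons eqxx; congr (_ `&` _).
rewrite big_seq_cond [RHS]big_seq_cond; apply: eq_bigr => i /andP[iI _].
by case: eqP => // ik; move: kI; rewrite -ik iI.
Qed.

Lemma independent_cylinder_cons k I B Bk : uniq I -> k \notin I ->
  measurable Bk -> (forall i, measurable (B i)) ->
  Pr (X k @^-1` Bk `&` cylinder I B) =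
  (Pr (X k @^-1` Bk) * Pr (cylinder I B))%E.
Proof.
move=> uI kI mBk mB.
pose B' i := if i == k then Bk else B i.
have mB' i : measurable (B' i) by rewrite /B'; case: eqP.
have := indX (I := k :: I) (B := B') _ mB'; rewrite /= kI uI => /(_ isT).
rewrite -/(cylinder (k :: I) B') /B' cylinder_cons // => ->.
rewrite big_cons eqxx /cylinder (indX uI mB); congr (_ * _)%E.
rewrite big_seq_cond [RHS]big_seq_cond; apply: eq_bigr => i /andP[iI _].
by case: eqP => // ik; move: kI; rewrite -ik iI.
Qed.

Section chain.
Context dT (T : measurableType dT) (F : T * R -> T)
  (mF : measurable_fun setT F) (t0 : T).

Fixpoint chain (n : nat) (om : Omega) : T :=
  if n is n'.+1 then F (chain n' om, X n' om) else t0.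

Definition chain_input (n : nat) (om : Omega) : T * R := (chain n om, X n om).

Lemma measurable_chain n : measurable_fun setT (chain n).
Proof.
elim: n => [|n IH] /=; first exact: measurable_cst.
by apply: measurableT_comp => //; exact: measurable_fun_pair.
Qed.

Lemma measurable_chain_input n : measurable_fun setT (chain_input n).
Proof. exact: measurable_fun_pair (measurable_chain n) (mX n). Qed.

Local Notation law_chain n := (distribution Pr (mfun_of (measurable_chain n))).

(* By induction on [n]: [chain_input n.+1] is a measurable function of
   [chain_input n] and [X n.+1], and both sides of the product rule are finite
   measures in [G] agreeing on rectangles. *)
Lemma chain_input_cylinder_indep n G I B :
  measurable G -> uniq I -> all (fun i => n < i)%N I ->
  (forall i, measurable (B i)) ->
  Pr (chain_input n @^-1` G `&` cylinder I B) =
  (Pr (chain_input n @^-1` G) * Pr (cylinder I B))%E.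
Proof.
elim: n G I B => [|n IH] G I B mG uI aI mB.
  have -> : chain_input 0 @^-1` G = X 0 @^-1` xsection G t0.
    by apply/seteqP; split => om /=; rewrite /xsection /= inE.
  apply: independent_cylinder_cons => //; last exact: measurable_xsection.
  by apply/negP => /(allP aI).
have mcyl := measurable_cylinder I mB.
have PI_ge0 : (0 <= fine (Pr (cylinder I B)))%R by apply: fine_ge0.
pose lhs := pushforward_measure (mrestr Pr mcyl) (measurable_chain_input n.+1).
pose rhs := mscale (NngNum PI_ge0)
  (pushforward_measure Pr (measurable_chain_input n.+1)).
suff : lhs G = rhs G.
  rewrite /lhs /rhs /= /mscale /= /mrestr /pushforward.
  by rewrite (fineK (fin_num_measure Pr _ mcyl)) muleC => ->.
apply: (finite_measure_prod_unique (m1 := lhs)) => //.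
  rewrite /lhs /= /mrestr /pushforward.
  rewrite (le_lt_trans (probability_le1 _ _)) ?ltry //.
  by apply: measurableI => //; exact: (measurable_funPTI (mfun_of (measurable_chain_input n.+1))).
move=> A B' mA mB'; rewrite /lhs /rhs /= /mscale /= /mrestr /pushforward.
have nI : n.+1 \notin I by apply/negP => /(allP aI); rewrite ltnn.
have mFA : measurable (F @^-1` A) by rewrite -[X in measurable X]setTI; exact: mF.
have aI' : all (fun i => n < i)%N (n.+1 :: I).
  by rewrite /= ltnSn /=; apply/allP => i /(allP aI) /ltnW.
pose B'' i := if i == n.+1 then B' else B i.
have mB'' i : measurable (B'' i) by rewrite /B''; case: eqP.
have -> : chain_input n.+1 @^-1` (A `*` B') =
    chain_input n @^-1` (F @^-1` A) `&` X n.+1 @^-1` B' by [].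
rewrite -setIA -cylinder_cons // IH //= ?nI // cylinder_cons //.
rewrite independent_cylinder_cons //.
have := IH (F @^-1` A) [:: n.+1] B'' mFA isT _ mB''.
rewrite /= ltnSn => /(_ isT).
rewrite cylinder_cons // /cylinder big_nil setIT => ->.
by rewrite (fineK (fin_num_measure Pr _ mcyl)) muleA [RHS]muleC.
Qed.

Lemma chain_input_rectangle n A B : measurable A -> measurable B ->
  Pr (chain_input n @^-1` (A `*` B)) =
  (Pr (chain n @^-1` A) * Pr (X 0 @^-1` B))%E.
Proof.
move=> mA mB; case: n => [|n].
  have [At0|At0] := pselect (A t0).
    have -> : chain_input 0 @^-1` (A `*` B) = X 0 @^-1` B.
      by apply/seteqP; split => om /=; [case|split].
    have -> : chain 0 @^-1` A = setT by apply/seteqP; split => om.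
    by rewrite probability_setT mul1e.
  have -> : chain_input 0 @^-1` (A `*` B) = set0.
    by apply/seteqP; split => om //= [].
  have -> : chain 0 @^-1` A = set0 by apply/seteqP; split => om.
  by rewrite measure0 mul0e.
have mFA : measurable (F @^-1` A) by rewrite -[X in measurable X]setTI; exact: mF.
have -> : chain_input n.+1 @^-1` (A `*` B) =
  chain_input n @^-1` (F @^-1` A) `&` X n.+1 @^-1` B by [].
have -> : chain n.+1 @^-1` A = chain_input n @^-1` (F @^-1` A) by [].
have := chain_input_cylinder_indep (n := n) (I := [:: n.+1]) (B := fun=> B) mFA isT.
rewrite /= ltnSn => /(_ isT (fun=> mB)).
by rewrite /cylinder big_cons big_nil setIT => ->; rewrite idX.
Qed.

Lemma chain_input_law n G : measurable G ->
  Pr (chain_input n @^-1` G) = (law_chain n \x mu)%E G.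
Proof.
move=> mG; symmetry.
apply: (product_measure_unique
  (m' := pushforward_measure Pr (measurable_chain_input n))) => // A B mA mB.
by rewrite /= /pushforward chain_input_rectangle.
Qed.

Lemma integral_chain_succ n (g : T -> \bar R) :
  measurable_fun setT g -> (forall t, (0 <= g t)%E) ->
  (\int[Pr]_om g (chain n.+1 om) =
   \int[law_chain n]_t \int[mu]_z g (F (t, z)))%E.
Proof.
move=> mg g0.
have mgF : measurable_fun setT (g \o F) by exact: measurableT_comp.
transitivity (\int[pushforward_measure Pr (measurable_chain_input n)]_q g (F q))%E.
  by rewrite (ge0_integral_pushforward (measurable_chain_input n)).
rewrite -(fubini_tonelli1 _ mgF) //; last by move=> q; exact: g0.
by apply: eq_measure_integral => A mA _; exact: chain_input_law.
Qed.

Lemma chain_superharmonic (V : T -> R) :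
  measurable_fun setT V -> (forall t, 0 <= V t) ->
  (forall t, \int[mu]_z (V (F (t, z)))%:E <= (V t)%:E)%E ->
  forall n, (\int[Pr]_om (V (chain n om))%:E <= (V t0)%:E)%E.
Proof.
move=> mV V0 Vsuper; have mVE : measurable_fun setT (EFin \o V) by exact/measurable_EFinP.
elim=> [|n IH].
  by rewrite /= integral_cst //= probability_setT mule1.
rewrite (integral_chain_succ _ (g := EFin \o V)); last 2 first.
- exact: mVE.
- by move=> t; rewrite lee_fin.
apply: le_trans IH.
rewrite -(ge0_integral_distribution (mfun_of (measurable_chain n)) mVE);
  last by move=> t; rewrite lee_fin.
apply: ge0_le_integral => //.
- by move=> t _; apply: integral_ge0 => z _; rewrite lee_fin.
- apply: (measurable_fun_fubini_tonelli_F (m2 := mu) (EFin \o V \o F)).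
    exact: measurableT_comp mVE mF.
  by move=> q; rewrite lee_fin.
- by move=> t _; exact: Vsuper.
Qed.

End chain.
End independent_inputs.

Section stopped_walk.
Context (R : realType) (d : measure_display) (Omega : measurableType d)
  (Pr : probability Omega R) (X : nat -> Omega -> R)
  (mX : forall k, measurable_fun setT (X k))
  (indX : mutually_independent Pr X) (idX : identically_distributed Pr X)
  (s : R) (v : R -> R) (mv : measurable_fun setT v) (vpos : forall z, 0 < v z)
  (eps : R) (eps_pos : 0 < eps).

Local Notation mu := (distribution Pr (mfun_of (mX 0))).
Local Notation p := (1 + eps).

Definition w (u : R) : R := fine (walk_w Pr (X 0) v u).

Lemma walk_wE u : walk_w Pr (X 0) v u = (\int[mu]_x (v (u + x))%:E)%E.
Proof. by apply: integral_walk_kernel => // z; exact: ltW. Qed.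

Lemma w_ge0 u : 0 <= w u.
Proof.
by rewrite /w fine_ge0 // walk_wE integral_ge0 // => x _; rewrite lee_fin ltW.
Qed.

Lemma measurable_w : measurable_fun setT w.
Proof.
have -> : w = fine \o fubini_F mu (fun q : R * R => (v (q.1 + q.2))%:E).
  by apply/funext => u; rewrite /w walk_wE.
apply: measurableT_comp; first exact: fine_measurable.
apply: measurable_fun_fubini_tonelli_F; last by move=> q; rewrite lee_fin ltW.
apply/measurable_EFinP; apply: measurableT_comp => //.
exact: measurable_funD measurable_fst measurable_snd.
Qed.

Definition ratio (u x : R) : R := (w u / v (u + x)) `^ p.

Lemma ratioE u x : ratio u x = w u `^ p * v (u + x) `^ (- p).
Proof. by rewrite /ratio powR_div // w_ge0. Qed.

Lemma measurable_ratio : measurable_fun setT (fun q : R * R => ratio q.1 q.2).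
Proof.
under eq_fun do rewrite ratioE.
apply: measurable_funM.
  exact: measurableT_comp (measurable_powR p) (measurableT_comp measurable_w measurable_fst).
apply: (measurableT_comp (measurable_powR (- p))); apply: (measurableT_comp mv).
exact: measurable_funD measurable_fst measurable_snd.
Qed.

(* One step of the chain (S_(n /\ tau), M_n); it is frozen once the walk has
   exceeded [s]. *)
Definition stopped_step (z : (R * R) * R) : R * R :=
  if z.1.1 <= s then (z.1.1 + z.2, z.1.2 * ratio z.1.1 z.2) else z.1.

Lemma measurable_stopped_step : measurable_fun setT stopped_step.
Proof.
have m11 : measurable_fun setT (fun z : (R * R) * R => z.1.1).
  exact: measurableT_comp measurable_fst measurable_fst.
have m12 : measurable_fun setT (fun z : (R * R) * R => z.1.2).
  exact: measurableT_comp measurable_snd measurable_fst.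
rewrite /stopped_step; apply: measurable_fun_ifT.
- by apply: measurable_fun_ler => //; exact: measurable_cst.
- apply/measurable_fun_pairP; split; first exact: measurable_funD measurable_snd.
  apply: measurable_funM => //.
  exact: measurableT_comp measurable_ratio (measurable_fun_pair m11 measurable_snd).
- exact: measurable_fst.
Qed.

Local Notation stopped_chain y := (chain X stopped_step (y, 1)).

Lemma walk0 y om : walk X y om 0 = y.
Proof. by rewrite /walk big_ord0 addr0. Qed.

Lemma walkS y om k : walk X y om k.+1 = walk X y om k + X k om.
Proof. by rewrite /walk big_ord_recr /= addrA. Qed.

Lemma stopped_chain_walk y om n :
  (forall k, (k < n)%N -> walk X y om k <= s) ->
  stopped_chain y n om =
  (walk X y om n, \prod_(k < n) ratio (walk X y om k) (X k om)).
Proof.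
elim: n => [|n IH] Hk; first by rewrite walk0 big_ord0.
rewrite /= IH; last by move=> k kn; apply: Hk; exact: ltnW.
by rewrite /stopped_step /= Hk // walkS big_ord_recr.
Qed.

Lemma stopped_chain_stop y om n j : s < (stopped_chain y n om).1 ->
  stopped_chain y (n + j) om = stopped_chain y n om.
Proof.
move=> sn; elim: j => [|j IH]; first by rewrite addn0.
by rewrite addnS /= IH /stopped_step /= leNgt sn.
Qed.

Definition exit_value (q : R * R) : R := if s < q.1 then `|q.2| else 0.

Lemma exit_value_ge0 q : 0 <= exit_value q.
Proof. by rewrite /exit_value; case: ifPn. Qed.

Lemma measurable_exit_value : measurable_fun setT exit_value.
Proof.
rewrite /exit_value; apply: measurable_fun_ifT.
- by apply: measurable_fun_ltr; [exact: measurable_cst|exact: measurable_fst].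
- exact: measurableT_comp (@normr_measurable R setT) measurable_snd.
- exact: measurable_cst.
Qed.

Lemma exit_value_nondecreasing y om :
  nondecreasing_seq (fun n => exit_value (stopped_chain y n om)).
Proof.
apply/nondecreasing_seqP => n.
have [sn|sn] := boolP (s < (stopped_chain y n om).1).
  by have := stopped_chain_stop 1 sn; rewrite addn1 => ->.
by rewrite {1}/exit_value (negbTE sn) exit_value_ge0.
Qed.

Lemma Lwalk_powR_limn y om : ((Lwalk Pr X v s y om) `^ p)%:E =
  limn (fun n => (exit_value (stopped_chain y n om))%:E).
Proof.
rewrite /Lwalk; case: pselect => [exit|noexit]; last first.
  have below k : walk X y om k <= s.
    by rewrite leNgt; apply/negP => sk; apply: noexit; exists k.
  rewrite powR0 ?gt_eqF ?addr_gt0 //.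
  have -> : (fun n => (exit_value (stopped_chain y n om))%:E) = fun=> 0%E.
    apply/funext => n; rewrite stopped_chain_walk => [|k _]; last exact: below.
    by rewrite /exit_value /= ltNge below.
  by rewrite lim_cst.
case: ex_minnP => tau stau taumin.
have below k : (k < tau)%N -> walk X y om k <= s.
  by move=> ktau; rewrite leNgt; apply/negP => /taumin; rewrite leqNgt ktau.
have chain_tau := stopped_chain_walk below.
have stop : s < (stopped_chain y tau om).1 by rewrite chain_tau.
apply/esym/lim_near_cst => //; near=> n.
have taun : (tau <= n)%N by near: n; exists tau.
rewrite -(subnKC taun) stopped_chain_stop // chain_tau /exit_value /= stau.
rewrite ger0_norm ?prodr_ge0 // => [|k _]; last exact: powR_ge0.
rewrite powR_prod => [|k]; last by rewrite divr_ge0 ?w_ge0 ?ltW.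
by congr (_%:E); apply: eq_bigr => k _; rewrite /ratio walkS.
Unshelve. all: by end_near.
Qed.

Context (delta1 : R) (delta1_pos : 0 < delta1)
  (h : R -> R) (mh : measurable_fun setT h) (h_ge : forall z, delta1 <= h z)
  (hyp : forall y, y <= s ->
     ((fine (walk_w Pr (X 0) v y) `^ (1 + eps))%:E *
       \int[walk_kernel Pr (X 0) y]_z (v z * h z)%:E
       <= (h y * v y `^ (2 + eps))%:E)%E)
  (delta2 : R) (delta2_pos : 0 < delta2)
  (v_ge : forall z, s < z -> delta2 <= v z).

Lemma h_gt0 z : 0 < h z.
Proof. exact: lt_le_trans delta1_pos (h_ge z). Qed.

Definition weight (u : R) : R := v u `^ (2 + eps) * h u.

Definition potential (q : R * R) : R := `|q.2| * weight q.1.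

Lemma weight_ge0 u : 0 <= weight u.
Proof. by rewrite /weight mulr_ge0 ?powR_ge0 // ltW // h_gt0. Qed.

Lemma potential_ge0 q : 0 <= potential q.
Proof. by rewrite /potential mulr_ge0 // weight_ge0. Qed.

Lemma measurable_potential : measurable_fun setT potential.
Proof.
apply: measurable_funM.
  exact: measurableT_comp (@normr_measurable R setT) measurable_snd.
apply: measurableT_comp measurable_fst.
by apply: measurable_funM => //; exact: measurableT_comp (measurable_powR _) mv.
Qed.

(* Below [s] the factor [v^-(1+eps)] of the ratio cancels [v^(2+eps)] down to
   [v], so the mean of the potential after one step is
   [|m| w^(1+eps) \int v h dP(u, .)], which [hyp] bounds by [|m| weight u]. *)
Lemma potential_stopped_step q :
  (\int[mu]_x (potential (stopped_step (q, x)))%:E <= (potential q)%:E)%E.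
Proof.
case: q => u m; rewrite /stopped_step /=.
have [us|us] := boolP (u <= s); last first.
  by rewrite integral_cst //= probability_setT mule1.
have step x : potential (u + x, m * ratio u x) =
    `|m| * w u `^ p * (v (u + x) * h (u + x)).
  have vux := vpos (u + x).
  have cancel : v (u + x) `^ (- p) * v (u + x) `^ (2 + eps) = v (u + x).
    rewrite -powRD ?(gt_eqF vux) ?implybT //.
    have -> : - p + (2 + eps) = 1 by ring.
    by rewrite powRr1 // ltW.
  rewrite /potential /weight /= ratioE normrM (@ger0_norm _ (_ * _)); last first.
    by rewrite mulr_ge0 // powR_ge0.
  by rewrite -[X in _ = _ * (X * _)]cancel; ring.
have mvh : measurable_fun setT (fun z => v z * h z) by exact: measurable_funM.
have vh_ge0 z : 0 <= v z * h z by rewrite mulr_ge0 // ltW // h_gt0.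
under eq_integral do rewrite step EFinM.
rewrite ge0_integralZl_EFin //; last 3 first.
- by move=> x _; rewrite lee_fin.
- apply/measurable_EFinP; apply: (measurableT_comp mvh).
  by apply: measurable_funD => //; exact: measurable_cst.
- by rewrite mulr_ge0 // powR_ge0.
rewrite -(integral_walk_kernel Pr (mX 0) u mvh vh_ge0).
rewrite EFinM -muleA /potential /weight /= [X in (_ <= X)%E]EFinM.
apply: lee_wpmul2l; first by rewrite lee_fin.
by rewrite mulrC; exact: hyp.
Qed.

Lemma integral_potential_stopped_chain y n :
  (\int[Pr]_om (potential (stopped_chain y n om))%:E <= (weight y)%:E)%E.
Proof.
have := chain_superharmonic (mX := mX) indX idX measurable_stopped_step (y, 1)
  measurable_potential potential_ge0 potential_stopped_step n.
by rewrite /potential normr1 mul1r.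
Qed.

Let C := delta1^-1 * delta2 `^ (- (2 + eps)).

Lemma C_ge0 : 0 <= C.
Proof. by rewrite mulr_ge0 ?powR_ge0 // invr_ge0 ltW. Qed.

Lemma exit_value_le_potential q : exit_value q <= C * potential q.
Proof.
rewrite /exit_value; case: ifPn => sq; last by rewrite mulr_ge0 ?C_ge0 ?potential_ge0.
have d2p_gt0 : 0 < delta2 `^ (2 + eps) by apply: powR_gt0.
have weight_ge : delta2 `^ (2 + eps) * delta1 <= weight q.1.
  rewrite /weight ler_pM ?powR_ge0 ?(ltW delta1_pos) //.
  apply: ge0_ler_powR; rewrite ?nnegrE ?(ltW delta2_pos) ?(ltW (vpos _)) ?v_ge //.
  by rewrite addr_ge0 // ltW.
have -> : `|q.2| = C * (`|q.2| * (delta2 `^ (2 + eps) * delta1)).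
  by rewrite /C powRN; field; rewrite (gt_eqF d2p_gt0) (gt_eqF delta1_pos).
by rewrite ler_wpM2l ?C_ge0 // /potential ler_wpM2l.
Qed.

Lemma measurable_exit_value_chain y n :
  measurable_fun setT (fun om => (exit_value (stopped_chain y n om))%:E).
Proof.
apply/measurable_EFinP; apply: (measurableT_comp measurable_exit_value).
exact: measurable_chain measurable_stopped_step _ _.
Qed.

Lemma integral_exit_value_le y n :
  (\int[Pr]_om (exit_value (stopped_chain y n om))%:E <= (C * weight y)%:E)%E.
Proof.
have mpot : measurable_fun setT (fun om => (potential (stopped_chain y n om))%:E).
  apply/measurable_EFinP; apply: (measurableT_comp measurable_potential).
  exact: measurable_chain measurable_stopped_step _ _.
apply: (@le_trans _ _ (\int[Pr]_om (C%:E * (potential (stopped_chain y n om))%:E))%E).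
  apply: ge0_le_integral => //.
  - by move=> om _; rewrite lee_fin exit_value_ge0.
  - exact: measurable_exit_value_chain.
  - by apply: measurable_funeM.
  - by move=> om _; rewrite -EFinM lee_fin exit_value_le_potential.
rewrite ge0_integralZl //; last 2 first.
- by move=> om _; rewrite lee_fin potential_ge0.
- by rewrite lee_fin C_ge0.
rewrite [X in (_ <= X)%E]EFinM; apply: lee_wpmul2l; first by rewrite lee_fin C_ge0.
exact: integral_potential_stopped_chain.
Qed.

Lemma integral_Lwalk_powR_le y :
  (\int[Pr]_om ((Lwalk Pr X v s y om) `^ p)%:E <= (C * weight y)%:E)%E.
Proof.
under eq_integral => om _ do rewrite Lwalk_powR_limn.
rewrite monotone_convergence //; last 3 first.
- exact: measurable_exit_value_chain.
- by move=> n om _; rewrite lee_fin exit_value_ge0.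
- by move=> om _; exact: exit_value_nondecreasing.
apply: lime_le; last by apply: nearW => n; exact: integral_exit_value_le.
apply: ereal_nondecreasing_is_cvgn => m n mn.
apply: ge0_le_integral => //.
- by move=> om _; rewrite lee_fin exit_value_ge0.
- exact: measurable_exit_value_chain.
- exact: measurable_exit_value_chain.
- by move=> om _; exact: exit_value_nondecreasing.
Qed.

End stopped_walk.

Theorem proposition2 (R : realType) (d : measure_display)
  (Omega : measurableType d) (Pr : probability Omega R)
  (X : nat -> Omega -> R)
  (mX : forall k, measurable_fun [set: Omega] (X k))
  (indX : mutually_independent Pr X)
  (idX : identically_distributed Pr X)
  (s : R) (v : R -> R) (mv : measurable_fun [set: R] v)
  (vpos : forall z, 0 < v z)
  (eps : R) (eps_pos : 0 < eps)
  (wfin : forall y, y <= s ->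
     (0 < walk_w Pr (X 0%N) v y)%E /\ (walk_w Pr (X 0%N) v y < +oo)%E)
  (delta1 : R) (delta1_pos : 0 < delta1)
  (h : R -> R) (mh : measurable_fun [set: R] h)
  (h_ge : forall z, delta1 <= h z)
  (hyp : forall y, y <= s ->
     ((fine (walk_w Pr (X 0%N) v y) `^ (1 + eps))%R%:E *
       \int[walk_kernel Pr (X 0%N) y]_z (v z * h z)%:E
       <= (h y * v y `^ (2 + eps))%R%:E)%E)
  (h_ge1 : forall z, s < z -> 1 <= h z)
  (delta2 : R) (delta2_pos : 0 < delta2)
  (v_ge : forall z, s < z -> delta2 <= v z) :
  forall y, y <= s ->
    (\int[Pr]_om ((Lwalk Pr X v s y om) `^ (1 + eps))%R%:E
      <= (delta1^-1 * delta2 `^ (- (2 + eps)) * v y `^ (2 + eps) * h y)%R%:E)%E.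
Proof.
move=> y _; rewrite -!mulrA mulrA.
exact: (integral_Lwalk_powR_le mX indX idX mv vpos eps_pos delta1_pos mh h_ge hyp delta2_pos v_ge).
Qed.
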